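(* For any instance $(\boldsymbol{D},k,B,\ell)$ of Feature Selection over an alphabet $\Sigma$, where $\boldsymbol{D}$ is an $m\times n$ matrix, one can construct in time $O(mn+k\cdot|\Sigma|^k)$ an equivalent instance $(\boldsymbol{A},k',B',\ell',\mathcal{R})$ of Constrained Clustering with Outliers over $\Sigma$ such that $\boldsymbol{A}$ is the transpose of $\boldsymbol{D}$, $k'=|\Sigma|^k$, $B'=B$ and $\ell'=\ell$.
   Context: Two instances are equivalent if one is a yes-instance if and only if the other is. $\Sigma$ is a finite set of non-negative integers (the alphabet). The Hamming distance $d_H(\boldsymbol{x},\boldsymbol{y})$ is the number of coordinates in which $\boldsymbol{x}$ and $\boldsymbol{y}$ differ. For a set $S$ of row indices and a matrix $\boldsymbol{D}$, $\boldsymbol{D}^{-S}$ is the matrix obtained from $\boldsymbol{D}$ by removing the rows with indices in $S$, and its columns are denoted $\boldsymbol{d}_{-S}^1,\dots,\boldsymbol{d}_{-S}^n$. A $p$-ary relation on $\Sigma$ is a collection of $p$-tuples with elements in $\Sigma$. An ordered set $\{\boldsymbol{c}_1,\dots,\boldsymbol{c}_p\}$ of vectors in $\Sigma^M$ satisfies a set $\mathcal{R}=\{R_1,\dots,R_M\}$ of $p$-ary relations on $\Sigma$ if $(\boldsymbol{c}_1[i],\dots,\boldsymbol{c}_p[i])\in R_i$ for all $1\le i\le M$. Feature Selection. Input: an alphabet $\Sigma$, an $m\times n$ matrix $\boldsymbol{D}$ with entries in $\Sigma$, a positive integer $k$, non-negative integers $B$ and $\ell$. Task: decide whether there are a subset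 $O\subset\{1,\dots,m\}$ of size at most $\ell$, a partition $\{I_1,\dots,I_k\}$ of $\{1,\dots,n\}$, and vectors $\boldsymbol{c}_1,\dots,\boldsymbol{c}_k\in\Sigma^{m-|O|}$ such that $\sum_{i=1}^k\sum_{j\in I_i}d_H(\boldsymbol{d}_{-O}^j,\boldsymbol{c}_i)\le B$. Constrained Clustering with Outliers. Input: an alphabet $\Sigma$, an $M\times N$ matrix $\boldsymbol{A}$ with columns $\boldsymbol{a}^1,\dots,\boldsymbol{a}^N\in\Sigma^M$, a positive integer $k'$, non-negative integers $B'$ and $\ell'$, and a set $\mathcal{R}=\{R_1,\dots,R_M\}$ of $k'$-ary relations on $\Sigma$. Task: decide whether there are a subset $O\subset\{1,\dots,N\}$ of size at most $\ell'$, a partition $\{I_1,\dots,I_{k'}\}$ of $\{1,\dots,N\}\setminus O$, and vectors $\boldsymbol{c}_1,\dots,\boldsymbol{c}_{k'}\in\Sigma^M$ such that $\{\boldsymbol{c}_1,\dots,\boldsymbol{c}_{k'}\}$ satisfies $\mathcal{R}$ and $\sum_{i=1}^{k'}\sum_{j\in I_i}d_H(\boldsymbol{a}^j,\boldsymbol{c}_i)\le B'$. Convention for both problem definitions: it is assumed, without loss of generality, that each cluster is non-empty, i.e. $I_i\ne\emptyset$ for every $i$ (otherwise one could probe smaller values for the actual number of non-empty clusters).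
   Formalization: Clusters may be empty in both problems, since with k'=|Σ|^k non-empty clusters the claim fails (Σ={0,1}, D of size 1×1, k=1, B=ℓ=0); for k≤n the equivalence is also proved with non-empty Feature Selection clusters. It is assumed that m,n≥1. *)

(* Defs.v *)
From HB Require Import structures.
From mathcomp Require Import all_boot all_order all_algebra finmap.

Set Implicit Arguments.
Unset Strict Implicit.
Unset Printing Implicit Defensive.

Local Open Scope nat_scope.

(** * The two problems *)

Definition hamming (T : eqType) (p : nat) (x y : 'cV[T]_p) : nat :=
  #|[set i : 'I_p | x i ord0 != y i ord0]|.

(* [remove_rows O D] is D^{-O}; its number of rows is #|~: O| = m - #|O|, and
   [enum_val] lists the remaining row indices in increasing order. *)
Definition remove_rows (T : Type) (m n : nat) (O : {set 'I_m})
    (D : 'M[T]_(m, n)) : 'M[T]_(#|~: O|, n) :=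
  rowsub (fun i : 'I_#|~: O| => enum_val i) D.

(* Clusters are indexed and may be empty.  Requiring them to be non-empty would
   make every Constrained Clustering instance with more clusters than columns
   a no-instance, although its empty clusters still have constrained centres. *)
Definition clustering (p q : nat) (X : {set 'I_q}) (I : 'I_p -> {set 'I_q}) :
    Prop :=
  (forall i i' : 'I_p, i != i' -> [disjoint I i & I i']) /\
  \bigcup_(i < p) I i = X.

Record fs_instance (Sigma : {fset nat}) (m n : nat) := FSInstance {
  fs_D : 'M[Sigma]_(m, n);
  fs_k : nat;
  fs_k_gt0 : 0 < fs_k;
  fs_B : nat;
  fs_l : nat
}.

Definition fs_solution (Sigma : {fset nat}) (m n : nat)
    (X : fs_instance Sigma m n) (O : {set 'I_m})
    (I : 'I_(fs_k X) -> {set 'I_n})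
    (c : 'I_(fs_k X) -> 'cV[Sigma]_#|~: O|) : Prop :=
  [/\ #|O| <= fs_l X,
      clustering [set: 'I_n] I &
      \sum_(i < fs_k X) \sum_(j in I i)
        hamming (col j (remove_rows O (fs_D X))) (c i) <= fs_B X].

Definition fs_yes (Sigma : {fset nat}) (m n : nat)
    (X : fs_instance Sigma m n) : Prop :=
  exists (O : {set 'I_m}) (I : 'I_(fs_k X) -> {set 'I_n})
    (c : 'I_(fs_k X) -> 'cV[Sigma]_#|~: O|), fs_solution I c.

(* For k <= n, requiring non-empty clusters loses no generality: a cluster with
   several columns can be split, and the parts keep its centre. *)
Definition fs_yes_nonempty (Sigma : {fset nat}) (m n : nat)
    (X : fs_instance Sigma m n) : Prop :=
  exists (O : {set 'I_m}) (I : 'I_(fs_k X) -> {set 'I_n})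
    (c : 'I_(fs_k X) -> 'cV[Sigma]_#|~: O|),
    fs_solution I c /\ (forall i, I i != set0).

Record cco_instance (Sigma : {fset nat}) (M N : nat) := CCOInstance {
  cco_A : 'M[Sigma]_(M, N);
  cco_k : nat;
  cco_k_gt0 : 0 < cco_k;
  cco_B : nat;
  cco_l : nat;
  cco_R : 'I_M -> {set cco_k.-tuple Sigma}
}.

Definition satisfies (T : finType) (M p : nat) (c : 'I_p -> 'cV[T]_M)
    (R : 'I_M -> {set p.-tuple T}) : Prop :=
  forall r : 'I_M, [tuple c i r ord0 | i < p] \in R r.

Definition cco_yes (Sigma : {fset nat}) (M N : nat)
    (Y : cco_instance Sigma M N) : Prop :=
  exists (O : {set 'I_N}) (I : 'I_(cco_k Y) -> {set 'I_N})
    (c : 'I_(cco_k Y) -> 'cV[Sigma]_M),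
    [/\ #|O| <= cco_l Y,
        clustering (~: O) I,
        satisfies c (cco_R Y) &
        \sum_(i < cco_k Y) \sum_(j in I i)
          hamming (col j (cco_A Y)) (c i) <= cco_B Y].

(** * Running time: structured programs of a unit-cost random access machine *)

Record state := State { reg : nat -> nat; mem : nat -> nat }.

Definition update (f : nat -> nat) (a x : nat) : nat -> nat :=
  fun b => if b == a then x else f b.

Definition set_reg (s : state) (r x : nat) : state :=
  State (update (reg s) r x) (mem s).

Definition set_mem (s : state) (a x : nat) : state :=
  State (reg s) (update (mem s) a x).

(* [r], [a], [b] are register numbers.  There is no multiplication, so that
   unit cost per instruction is a realistic measure. *)
Inductive cmd : Type :=
| Const (r x : nat)   (* reg r := x *)
| Add (r a b : nat)   (* reg r := reg a + reg b *)
| Sub (r a b : nat)   (* reg r := reg a - reg b, truncated at 0 *)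
| Read (r a : nat)    (* reg r := mem (reg a) *)
| Store (a b : nat)   (* mem (reg a) := reg b *)
| Skip
| Seq (c1 c2 : cmd)
| If (r : nat) (c1 c2 : cmd)   (* tests reg r <> 0 *)
| While (r : nat) (c : cmd).   (* tests reg r <> 0 *)

(* [exec c s t s']: started in [s], [c] halts in [s'] after [t] steps; every
   instruction and every test is one step. *)
Inductive exec : cmd -> state -> nat -> state -> Prop :=
| exec_const r x s : exec (Const r x) s 1 (set_reg s r x)
| exec_add r a b s : exec (Add r a b) s 1 (set_reg s r (reg s a + reg s b))
| exec_sub r a b s : exec (Sub r a b) s 1 (set_reg s r (reg s a - reg s b))
| exec_read r a s : exec (Read r a) s 1 (set_reg s r (mem s (reg s a)))
| exec_store a b s : exec (Store a b) s 1 (set_mem s (reg s a) (reg s b))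
| exec_skip s : exec Skip s 1 s
| exec_seq c1 c2 s s1 s2 t1 t2 :
    exec c1 s t1 s1 -> exec c2 s1 t2 s2 -> exec (Seq c1 c2) s (t1 + t2) s2
| exec_if_true r c1 c2 s s1 t :
    reg s r != 0 -> exec c1 s t s1 -> exec (If r c1 c2) s t.+1 s1
| exec_if_false r c1 c2 s s1 t :
    reg s r = 0 -> exec c2 s t s1 -> exec (If r c1 c2) s t.+1 s1
| exec_while_stop r c s : reg s r = 0 -> exec (While r c) s 1 s
| exec_while_loop r c s s1 s2 t1 t2 :
    reg s r != 0 -> exec c s t1 s1 -> exec (While r c) s1 t2 s2 ->
    exec (While r c) s (t1 + t2).+1 s2.

(** * Representation of instances *)

Definition holds_seq (s : state) (a : nat) (xs : seq nat) : Prop :=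
  forall i : nat, i < size xs -> mem s (a + i) = nth 0 xs i.

(* The alphabet is listed without repetition, in an arbitrary order. *)
Definition holds_alphabet (s : state) (a : nat) (Sigma : {fset nat}) : Prop :=
  exists2 e : seq nat, perm_eq e Sigma & holds_seq s a e.

(* Row-major storage. *)
Definition holds_matrix (Sigma : {fset nat}) (p q : nat) (s : state) (a : nat)
    (Q : 'M[Sigma]_(p, q)) : Prop :=
  forall (i : 'I_p) (j : 'I_q), mem s (a + (i * q + j)) = val (Q i j).

(* A relation is stored as a number of tuples followed by these tuples. *)
Definition holds_relation (Sigma : {fset nat}) (p : nat) (s : state) (a : nat)
    (R : {set p.-tuple Sigma}) : Prop :=
  exists ts : seq (p.-tuple Sigma),
    [/\ ts =i R,
        mem s a = size ts &
        holds_seq s a.+1 (flatten [seq map val (tval u) | u <- ts])].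

(* The contents of all other registers and memory cells are unspecified. *)
Definition fs_input (Sigma : {fset nat}) (m n : nat) (s : state)
    (X : fs_instance Sigma m n) : Prop :=
  (reg s 0 = #|` Sigma|%fset /\ reg s 1 = m /\ reg s 2 = n /\
   reg s 3 = fs_k X /\ reg s 4 = fs_B X /\ reg s 5 = fs_l X) /\
  holds_alphabet s 0 Sigma /\
  holds_matrix s #|` Sigma|%fset (fs_D X).

(* Registers 6, 7, 8 hold the addresses of the alphabet, of the matrix and of
   a table whose r-th entry is the address of R_r.  Equal relations may share
   their storage: M separate copies of a relation with k tuples of length
   |Sigma|^k would not fit in the time bound O(mn + k |Sigma|^k). *)
Definition cco_output (Sigma : {fset nat}) (M N : nat) (s : state)
    (Y : cco_instance Sigma M N) : Prop :=
  (reg s 0 = #|` Sigma|%fset /\ reg s 1 = M /\ reg s 2 = N /\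
   reg s 3 = cco_k Y /\ reg s 4 = cco_B Y /\ reg s 5 = cco_l Y) /\
  holds_alphabet s (reg s 6) Sigma /\
  holds_matrix s (reg s 7) (cco_A Y) /\
  (forall r : 'I_M, holds_relation s (mem s (reg s 8 + r)) (cco_R Y r)).

(* Main.v *)
(* Call W_s, for s < |Sigma|^k, the words of length k over Sigma.  The center of
   cluster s may only be of the form (W_s[f 1], ..., W_s[f n]) with the same
   f : {1..n} -> {1..k} for all s; this is the constraint that row j of the
   centers lies in R = {(W_s[i])_s | i <= k}.  Such an f is a partition of the
   columns of D, and sending row r of D to the word (c_1[r], ..., c_k[r]) of the
   entries of the centers of Feature Selection exchanges the two kinds of
   solutions without changing the cost.

   Taking for W_s the base-|Sigma| digits of s, tuple i of R is periodic: each
   letter is repeated |Sigma|^i times.  It can thus be written with counters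
   only, in constant time per entry.  The machine only appends to its memory, so
   its loop invariants just compare memory with the intended final contents. *)

Require Import Defs.
From HB Require Import structures.
From mathcomp Require Import all_boot all_order all_algebra finmap zify.

Set Implicit Arguments.
Unset Strict Implicit.
Unset Printing Implicit Defensive.

(* Gives back to [mem] and [Sub] the meanings that MathComp shadows. *)
Import Defs.

Local Open Scope nat_scope.

(** * Equivalence of the instances *)

(** Induction on the number of values missed by [f]. A missed [y0] forces a collision because
    [#|T| <= #|S|]; one colliding point is redirected to [y0], and [h] remembers its old value. For
    cluster assignments, this splits clusters until none is empty. *)
Lemma factor_through_surjection (S T : finType) (f : S -> T) :
  #|T| <= #|S| ->
  exists (g : S -> T) (h : T -> T),
    (forall y, exists x, g x = y) /\ (forall x, h (g x) = f x).
Proof.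
move=> leTS; have [p] := ubnP #|~: [set f x | x in S]|.
elim: p f => // p IHp f; rewrite ltnS => le_p.
have [/set0Pn [y0 y0_nin]|/negPn/eqP imT] :=
  boolP (~: [set f x | x in S] != set0); last first.
  exists f, id; split=> // y.
  have /imsetP[x _ ->] : y \in [set f x | x in S].
    by move/setP/(_ y): imT; rewrite in_set0 in_setC => /negbFE.
  by exists x.
have /injectivePn[x1 [x2 x12 fx12]] : ~~ injectiveb f.
  apply/negP => /injectiveP inj_f.
  have : #|[set f x | x in S]| < #|T|.
    by rewrite -(cardsC [set f x | x in S]) -addn1 leq_add2l card_gt0;
       apply/set0Pn; exists y0.
  by rewrite card_imset // ltnNge leTS.
have fNy0 x : f x != y0.
  by apply/eqP => fx; move: y0_nin; rewrite in_setC -fx imset_f.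
pose f1 x := if x == x1 then y0 else f x.
have [|g [h [g_surj hg]]] := IHp f1.
  apply: leq_trans le_p; apply/proper_card/properP; split; last first.
    exists y0 => //; rewrite in_setC negbK.
    by apply/imsetP; exists x1; rewrite // /f1 eqxx.
  apply/subsetP => y; rewrite !in_setC; apply: contra => /imsetP[x _ ->].
  have [->|xNx1] := eqVneq x x1.
    by apply/imsetP; exists x2; rewrite // /f1 eq_sym (negbTE x12).
  by apply/imsetP; exists x; rewrite // /f1 (negbTE xNx1).
(* [f1] takes the value [y0] only at [x1], so sending [y0] back to [f x1] recovers [f]. *)
exists g, (fun y => if h y == y0 then f x1 else h y); split=> // x.
rewrite hg /f1; case: (eqVneq x x1) => [->|_]; first by rewrite eqxx.
by rewrite (negbTE (fNy0 x)).
Qed.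

Lemma clustering_preim (p q : nat) (X : {set 'I_q}) (f : 'I_q -> 'I_p) :
  clustering X (fun i => [set j in X | f j == i]).
Proof.
split=> [i i' ii'|].
  rewrite -setI_eq0; apply/eqP/setP => j; rewrite !inE.
  case: (j \in X) => //=; apply/negP => /andP[/eqP-> /eqP fj].
  by rewrite fj eqxx in ii'.
apply/setP => j; apply/bigcupP/idP => [[i _]|jX].
  by rewrite inE => /andP[].
by exists (f j); rewrite // inE jX eqxx.
Qed.

Lemma clusteringP (p q : nat) (X : {set 'I_q}) (I : 'I_p -> {set 'I_q}) :
  0 < p -> clustering X I ->
  exists f : 'I_q -> 'I_p, forall i, I i = [set j in X | f j == i].
Proof.
move=> p_gt0 [disjI coverI].
(* The default index is only reached outside [X], where no cluster contains [j]. *)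
exists (fun j => odflt (Ordinal p_gt0) [pick i | j \in I i]) => i.
apply/setP => j; rewrite inE; case: pickP => [i' /= jIi'|/= jNI]; last first.
  rewrite (jNI i) -coverI; apply/esym/negP => /andP[/bigcupP[i' _]].
  by rewrite jNI.
have -> : j \in X by rewrite -coverI; apply/bigcupP; exists i'.
have [<- //|ii'] := eqVneq i' i.
by rewrite (disjointFr (disjI _ _ ii') jIi').
Qed.

Lemma sum_clusters (p q : nat) (X : {set 'I_q}) (f : 'I_q -> 'I_p)
    (F : 'I_p -> 'I_q -> nat) :
  \sum_(i < p) \sum_(j in [set j in X | f j == i]) F i j =
  \sum_(j in X) F (f j) j.
Proof.
rewrite (partition_big f xpredT) //=; apply: eq_bigr => i _.
apply: eq_big => [j|j]; first by rewrite inE.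
by rewrite inE => /andP[_ /eqP->].
Qed.

Lemma hammingE (T : eqType) (p : nat) (x y : 'cV[T]_p) :
  hamming x y = \sum_(i < p) (x i ord0 != y i ord0).
Proof.
rewrite /hamming -sum1_card big_mkcond /=.
by apply: eq_bigr => i _; rewrite inE; case: (_ != _).
Qed.

Section FeatureSelection.

Variables (Sigma : {fset nat}) (m n : nat) (X : fs_instance Sigma m n).

Let D := fs_D X.
Let k := fs_k X.

(** Centers are defined on all rows, which frees their type from [O]. Summing over rows first gives
    the cost the shape of a clustering cost for the columns of the transpose. *)
Definition fs_cost (O : {set 'I_m}) (f : 'I_n -> 'I_k)
    (c : 'I_k -> 'I_m -> Sigma) : nat :=
  \sum_(r in ~: O) \sum_(j < n) (D r j != c (f j) r).

Lemma sum_hamming_remove_rows (O : {set 'I_m}) (f : 'I_n -> 'I_k)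
    (c : 'I_k -> 'cV[Sigma]_#|~: O|) (c' : 'I_k -> 'I_m -> Sigma) :
  (forall i x, c i x ord0 = c' i (enum_val x)) ->
  \sum_(i < k) \sum_(j in [set j in [set: 'I_n] | f j == i])
     hamming (col j (remove_rows O D)) (c i) = fs_cost O f c'.
Proof.
move=> cc'; rewrite (sum_clusters _ _ (fun i j => hamming _ (c i))).
rewrite (eq_bigl xpredT) => [|j]; last by rewrite inE.
under eq_bigr => j _ do rewrite hammingE.
rewrite exchange_big /fs_cost [RHS]big_enum_val; apply: eq_bigr => x _.
by apply: eq_bigr => j _; rewrite !mxE cc'.
Qed.

Lemma fs_yesP : 0 < n ->
  fs_yes X <->
  exists (O : {set 'I_m}) (f : 'I_n -> 'I_k) (c : 'I_k -> 'I_m -> Sigma),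
    #|O| <= fs_l X /\ fs_cost O f c <= fs_B X.
Proof.
move=> n_gt0; split=> [[O [I [c [Ol IX cost]]]]|[O [f [c [Ol cost]]]]].
  have [f If] := clusteringP (fs_k_gt0 X) IX.
  (* On the rows in [O] the center is arbitrary; an entry of the first column of [D] supplies a
     letter. *)
  pose c' i r := if [pick x : 'I_#|~: O| | enum_val x == r] is Some x
    then c i x ord0 else D r (Ordinal n_gt0).
  exists O, f, c'; split=> //.
  rewrite -(@sum_hamming_remove_rows O f c) => [|i x].
    by move: cost; congr (_ <= _); apply: eq_bigr => i _; rewrite If.
  rewrite /c'; case: pickP => [y /eqP/enum_val_inj-> //|/(_ x)].
  by rewrite eqxx.
exists O, (fun i => [set j in [set: 'I_n] | f j == i]).
exists (fun i => (\col_x c i (enum_val x))%R); split=> //.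
  exact: clustering_preim.
by rewrite (@sum_hamming_remove_rows _ _ _ c) // => i x; rewrite mxE.
Qed.

Lemma fs_yes_nonemptyP : 0 < n -> k <= n -> fs_yes X <-> fs_yes_nonempty X.
Proof.
move=> n_gt0 le_kn; split=> [/(fs_yesP n_gt0)|]; last first.
  by move=> [O [I [c [sol _]]]]; exists O, I, c.
move=> [O [f [c [Ol cost]]]].
have [|g [h [g_surj hg]]] := factor_through_surjection f.
  by rewrite !card_ord.
exists O, (fun i => [set j in [set: 'I_n] | g j == i]).
(* New cluster [i] inherits the center of old cluster [h i], so column [j] is still compared with
   [c (f j)]. *)
exists (fun i => (\col_x c (h i) (enum_val x))%R); split; last first.
  move=> i; have [j <-] := g_surj i; apply/set0Pn; exists j.
  by rewrite !inE eqxx.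
split=> //; first exact: clustering_preim.
rewrite (@sum_hamming_remove_rows _ _ _ (c \o h)) => [|i x]; last first.
  by rewrite mxE.
apply: leq_trans cost; apply/eq_leq.
by apply: eq_bigr => r _; apply: eq_bigr => j _; rewrite /= hg.
Qed.

Variables (K : nat) (W : 'I_K -> 'I_k -> Sigma).

Definition letter_relation : {set K.-tuple Sigma} :=
  [set [tuple W s i | s < K] | i : 'I_k].

Definition cco_of_fs (K_gt0 : 0 < K) : cco_instance Sigma n m :=
  CCOInstance (fs_D X)^T%R K_gt0 (fs_B X) (fs_l X) (fun=> letter_relation).

Lemma cco_of_fsP (K_gt0 : 0 < K) :
  0 < n -> (forall u : 'I_k -> Sigma, exists s, W s =1 u) ->
  fs_yes X <-> cco_yes (cco_of_fs K_gt0).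
Proof.
move=> n_gt0 W_surj.
(* Serves both directions: [D r j] meets the same letter whether column [j] is compared with its
   center or row [r] with its word. *)
have costE (O : {set 'I_m}) (f : 'I_n -> 'I_k) c g (C : 'I_K -> 'cV[Sigma]_n) :
    (forall r j, C (g r) j ord0 = c (f j) r) ->
  \sum_(s < K) \sum_(r in [set r in ~: O | g r == s])
     hamming (col r D^T%R) (C s) = fs_cost O f c.
  move=> Cc; rewrite (sum_clusters _ _ (fun s r => hamming _ (C s))).
  apply: eq_bigr => r _; rewrite hammingE; apply: eq_bigr => j _.
  by rewrite !mxE Cc.
split=> [/(fs_yesP n_gt0)[O [f [c [Ol cost]]]]|[O [I [C [Ol IO satC cost]]]]].
  have /fin_all_exists[g gP] (r : 'I_m) : exists s, W s =1 c^~ r.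
    exact: W_surj.
  exists O, (fun s => [set r in ~: O | g r == s]).
  exists (fun s => (\col_j W s (f j))%R); split=> //=.
  - exact: clustering_preim.
  - move=> j; apply/imsetP; exists (f j) => //.
    by apply: eq_from_tnth => s; rewrite !tnth_mktuple mxE.
  - by rewrite (costE _ f c) // => r j; rewrite mxE gP.
have [g Ig] := clusteringP K_gt0 IO.
(* The constraint on row [j] of the centers names a tuple index, which becomes the cluster of column
   [j]. If equal tuples have several indices, any choice works. *)
have /fin_all_exists[f fP] (j : 'I_n) :
    exists i, forall s, C s j ord0 = W s i.
  have /imsetP[i _ Ei] := satC j; exists i => s.
  by move/(congr1 (fun t : K.-tuple Sigma => tnth t s)): Ei; rewrite !tnth_mktuple.
apply/(fs_yesP n_gt0); exists O, f, (fun i r => W (g r) i); split=> //.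
rewrite -(costE _ _ _ g C) => [|r j]; last by rewrite fP.
by move: cost; congr (_ <= _); apply: eq_bigr => s _; rewrite Ig.
Qed.

End FeatureSelection.

(** Horner's rule: the lowest digit is split off and the shifted sequence [d \o succn] is handled by
    induction. Hence the [q ^ k] digit strings exhaust the words. *)
Lemma digits_surj (q k : nat) (d : nat -> nat) :
  (forall i, d i < q) ->
  exists2 s, s < q ^ k & forall i, i < k -> s %/ q ^ i %% q = d i.
Proof.
elim: k d => [|k IHk] d lt_dq; first by exists 0.
have [s lt_s sP] := IHk (d \o succn) (fun i => lt_dq i.+1).
have q_gt0 : 0 < q by apply: leq_ltn_trans (lt_dq 0).
exists (s * q + d 0).
  rewrite expnSr; apply: leq_trans (_ : s.+1 * q <= _).
    by rewrite mulSnr ltn_add2l.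
  by rewrite leq_mul2r lt_s orbT.
case=> [_|i]; first by rewrite expn0 divn1 modnMDl modn_small.
rewrite ltnS => lt_ik; rewrite -[d i.+1]/((d \o succn) i) -sP //.
by rewrite expnS divnMA divnMDl // (divn_small (lt_dq 0)) addn0.
Qed.

(** * Timed correctness of programs *)

Definition terminates (c : cmd) (s : state) (T : nat) (Q : state -> Prop) :=
  exists t s', [/\ exec c s t s', t <= T & Q s'].

Fixpoint loop_free (c : cmd) : bool :=
  match c with
  | Seq c1 c2 | If _ c1 c2 => loop_free c1 && loop_free c2
  | While _ _ => false
  | _ => true
  end.

(* [run] and [cost] are junk on programs with loops. *)
Fixpoint run (c : cmd) (s : state) : state :=
  match c with
  | Const r x => set_reg s r x
  | Add r a b => set_reg s r (reg s a + reg s b)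
  | Sub r a b => set_reg s r (reg s a - reg s b)
  | Read r a => set_reg s r (mem s (reg s a))
  | Store a b => set_mem s (reg s a) (reg s b)
  | Seq c1 c2 => run c2 (run c1 s)
  | If r c1 c2 => if reg s r == 0 then run c2 s else run c1 s
  | Skip | While _ _ => s
  end.

Fixpoint cost (c : cmd) : nat :=
  match c with
  | Seq c1 c2 => cost c1 + cost c2
  | If _ c1 c2 => (maxn (cost c1) (cost c2)).+1
  | _ => 1
  end.

Fixpoint writes (c : cmd) : seq nat :=
  match c with
  | Const r _ | Add r _ _ | Sub r _ _ | Read r _ => [:: r]
  | Seq c1 c2 | If _ c1 c2 => writes c1 ++ writes c2
  | While _ c1 => writes c1
  | Store _ _ | Skip => [::]
  end.

(** Only registers are framed: [writes] is computed from the program, so preservation is decided by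
    evaluation. Memory is left to the assertions. *)
Definition frame (c : cmd) (s s' : state) : Prop :=
  forall x, x \notin writes c -> reg s' x = reg s x.

Lemma exec_frame c s t s' : exec c s t s' -> frame c s s'.
Proof.
rewrite /frame.
elim=> {c s t s'} //=; try by move=> *; rewrite /update -[_ == _]mem_seq1 ifN.
- move=> c1 c2 s s1 s2 t1 t2 _ IH1 _ IH2 x; rewrite mem_cat negb_or.
  by case/andP=> /IH1 <- /IH2.
- by move=> r c1 c2 s s1 t _ _ IH x; rewrite mem_cat negb_or => /andP[/IH].
- by move=> r c1 c2 s s1 t _ _ IH x; rewrite mem_cat negb_or => /andP[_ /IH].
- by move=> r c s s1 s2 t1 t2 _ _ IH1 _ IH2 x xc; rewrite IH2 ?IH1.
Qed.

Lemma exec_run c s :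
  loop_free c -> exists2 t, t <= cost c & exec c s t (run c s).
Proof.
elim: c s => [r x|r a b|r a b|r a|a b||c1 IH1 c2 IH2|r c1 IH1 c2 IH2|//] s /=;
  try by exists 1 => //; constructor.
- case/andP=> /(IH1 s)[t1 le1 ex1] /(IH2 (run c1 s))[t2 le2 ex2].
  by exists (t1 + t2); [exact: leq_add | exact: exec_seq ex1 ex2].
- case/andP=> /(IH1 s)[t1 le1 ex1] /(IH2 s)[t2 le2 ex2].
  case: eqP => [r0|/eqP r0].
    exists t2.+1; last exact: exec_if_false.
    by rewrite ltnS (leq_trans le2) ?leq_maxr.
  exists t1.+1; last exact: exec_if_true.
  by rewrite ltnS (leq_trans le1) ?leq_maxl.
Qed.

Lemma terminates_run c s T (Q : state -> Prop) :
  loop_free c -> cost c <= T -> Q (run c s) -> terminates c s T Q.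
Proof.
move=> /(exec_run s)[t le_t ex_c] le_T Qc.
by exists t, (run c s); split=> //; apply: leq_trans le_T.
Qed.

(** The frame of [c1] is handed to the second part, so [Q1] need not mention the registers that [c1]
    leaves alone. *)
Lemma terminates_seq c1 c2 s T1 T2 (Q1 Q : state -> Prop) :
  terminates c1 s T1 Q1 ->
  (forall s1, Q1 s1 -> frame c1 s s1 -> terminates c2 s1 T2 Q) ->
  terminates (Seq c1 c2) s (T1 + T2) Q.
Proof.
move=> [t1 [s1 [ex1 le1 Qs1]]] /(_ s1 Qs1 (exec_frame ex1)).
move=> [t2 [s2 [ex2 le2 Qs2]]]; exists (t1 + t2), s2.
by split; [exact: exec_seq ex1 ex2 | exact: leq_add |].
Qed.

Lemma terminates_weaken c s T (Q1 Q : state -> Prop) :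
  (forall s', Q1 s' -> frame c s s' -> Q s') ->
  terminates c s T Q1 -> terminates c s T Q.
Proof.
move=> Q1Q [t [s' [ex le Qs]]]; exists t, s'; split=> //.
by apply: Q1Q => //; apply: exec_frame ex.
Qed.

Lemma terminates_leq c s T T' (Q : state -> Prop) :
  T <= T' -> terminates c s T Q -> terminates c s T' Q.
Proof.
move=> le_T [t [s' [ex le Qs]]].
by exists t, s'; split=> //; apply: leq_trans le_T.
Qed.

(* Throughout, register 6 holds 0, register 10 holds 1, and register 9 holds
   the address of the next cell to be written. *)
Definition For (r b : nat) (c : cmd) : cmd :=
  Seq (Add r b 6) (While r (Seq c (Sub r r 10))).

(** The counter runs downwards: when it holds [d], [N - d] rounds are done, and the induction is on
    [d]. Each round adds a test and a decrement to [T]; the initial copy and the last failing test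
    give the final 2. [Inv] must ignore [r], which changes outside [c]. *)
Lemma terminates_for r b c s N T (Inv : nat -> state -> Prop) :
  [&& r \notin 6 :: 10 :: writes c, 6 \notin writes c & 10 \notin writes c] ->
  reg s 6 = 0 -> reg s 10 = 1 -> reg s b = N ->
  (forall i s1 x, Inv i s1 -> Inv i (set_reg s1 r x)) ->
  Inv 0 s ->
  (forall i s1, i < N -> Inv i s1 -> frame (For r b c) s s1 ->
     terminates c s1 T (Inv i.+1)) ->
  terminates (For r b c) s (N * T.+2 + 2) (Inv N).
Proof.
rewrite !inE !negb_or => /and3P[/and3P[r6 r10 rc] c6 c10] s6 s10 sb InvR Inv0.
move=> InvS.
have frame_refl s1 : (forall x, x != r -> reg s1 x = reg s x) ->
    frame (For r b c) s s1.
  by move=> ss1 x; rewrite /= inE negb_or => /andP[/ss1].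
suff loop d s1 : d <= N -> reg s1 r = d -> Inv (N - d) s1 ->
    frame (For r b c) s s1 ->
  terminates (While r (Seq c (Sub r r 10))) s1 (d * T.+2 + 1) (Inv N).
  have [] := loop N (run (Add r b 6) s) => //=.
  - by rewrite /update eqxx s6 sb addn0.
  - by rewrite subnn; apply: InvR.
  - by apply: frame_refl => x xr; rewrite /= /update (negbTE xr).
  move=> t [s' [ex le Q]]; exists (1 + t), s'; split=> //; last by lia.
  by apply: exec_seq ex; apply: exec_add.
elim: d s1 => [|d IHd] s1 le_dN s1r Inv1 fr1.
  by exists 1, s1; split=> //; [apply: exec_while_stop | rewrite subn0 in Inv1].
have s1_10 : reg s1 10 = 1.
  by rewrite fr1 //= inE mem_cat !inE eq_sym (negbTE r10) (negbTE c10).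
have [|t1 [s2 [ex2 le2 Inv2]]] := InvS (N - d.+1) s1 _ Inv1 fr1; first by lia.
have s2r : reg s2 r = d.+1 by rewrite (exec_frame ex2).
have s2_10 : reg s2 10 = 1 by rewrite (exec_frame ex2).
have := IHd (set_reg s2 r d).
case; first exact: ltnW.
- by rewrite /= /update eqxx.
- by apply: InvR; move: Inv2; rewrite subnSK.
- move=> x xw; move: (xw); rewrite /= !(inE, mem_cat) !negb_or.
  case/and3P=> xr xc _; rewrite /update (negbTE xr).
  by rewrite (exec_frame ex2) // fr1.
move=> t2 [s3 [ex3 le3 Inv3]]; exists ((t1 + 1) + t2).+1, s3.
split=> //; last by nia.
apply: exec_while_loop ex3; first by rewrite s1r.
apply: exec_seq ex2 _.
have -> : set_reg s2 r d = set_reg s2 r (reg s2 r - reg s2 10).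
  by rewrite s2r s2_10 subn1.
exact: exec_sub.
Qed.

Local Notation "c1 ;; c2" := (Seq c1 c2) (at level 60, right associativity).

Definition push (a : nat) : cmd := Store 9 a ;; Add 9 9 10.

(** [F] is the intended final memory, the same in all phases, so every cell below [p] reads back as
    a value of [F]. *)
Definition written (F : nat -> nat) (p : nat) (s : state) : Prop :=
  reg s 9 = p /\ forall a, a < p -> mem s a = F a.

Lemma written_push F p s a :
  written F p s -> reg s 10 = 1 -> reg s a = F p ->
  written F p.+1 (run (push a) s).
Proof.
move=> [s9 memF] s10 sa; rewrite /push /=; split=> /=.
  by rewrite /update /= s9 s10 addn1.
move=> b; rewrite /update s9 sa ltnS leq_eqVlt; case: eqP => [->//|_ /=].
exact: memF.
Qed.

(** These registers stay fixed from the end of the initialisation up to [write_header]. *)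
Record env (q m n k : nat) (s : state) : Prop := Env {
  env_q : reg s 0 = q; env_m : reg s 1 = m; env_n : reg s 2 = n;
  env_k : reg s 3 = k; env_0 : reg s 6 = 0; env_1 : reg s 10 = 1 }.

Lemma env_frame c q m n k s s' :
  frame c s s' -> env q m n k s ->
  all (fun x => x \notin writes c) [:: 0; 1; 2; 3; 6; 10] -> env q m n k s'.
Proof.
move=> fr [s0 s1 s2 s3 s6 s10] /and5P[c0 c1 c2 c3 /and3P[c6 c10 _]].
by split; rewrite fr.
Qed.

(** * The program *)

(** Register 9 starts at [q], the end of the alphabet; repeated addition of [n] moves it past the
    input matrix without a multiplication. *)
Definition skip_matrix : cmd := For 11 1 (Add 9 9 2).

(** Register 15 points to the top of the current column of the input matrix, and register 12
    descends that column with stride [n]. *)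
Definition write_transpose : cmd :=
  Add 15 0 6 ;;
  For 11 2
    (Add 12 15 6 ;;
     For 14 1 (Read 13 12 ;; push 13 ;; Add 12 12 2) ;;
     Add 15 15 10).

(** All [n] entries are the address just behind the table, where the one shared relation begins; its
    first cell is the number [k] of tuples. *)
Definition write_table : cmd :=
  Add 13 9 2 ;; For 11 2 (push 13) ;; push 3.

(** Repeated addition costs O(q), so all the powers together cost O(kq), within the time bound. *)
Definition mul_q : cmd :=
  Const 18 0 ;; For 14 0 (Add 18 18 17) ;; Add 17 18 6.

Definition power : cmd := Const 17 1 ;; For 11 3 mul_q ;; Add 16 17 6.

(* Register 17 holds [q ^ i] while the [i]-th tuple is written, register 12 the
   current letter and register 14 the number of its remaining repetitions. *)
Definition write_letter : cmd :=
  Read 13 12 ;; push 13 ;; Sub 14 14 10 ;;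
  If 14 Skip
    (Add 14 17 6 ;; Add 12 12 10 ;; Sub 13 0 12 ;;
     If 13 Skip (Add 12 6 6)).

Definition write_tuples : cmd :=
  Const 17 1 ;;
  For 11 3 ((Const 12 0 ;; Add 14 17 6) ;; For 15 16 write_letter ;; mul_q).

(** Transposition swaps the dimensions. Register 6, which holds 0, is already the address of the
    alphabet, and registers 4 and 5 keep the budget and the number of outliers. *)
Definition write_header : cmd :=
  Add 13 1 6 ;; Add 1 2 6 ;; Add 2 13 6 ;; Add 3 16 6.

Definition reduction : cmd :=
  (Const 10 1 ;; Const 6 0 ;; Add 9 0 6) ;;
  skip_matrix ;; Add 7 9 6 ;; write_transpose ;; Add 8 9 6 ;; write_table ;;
  power ;; write_tuples ;; write_header.

(** * Correctness and cost of the pieces of the program *)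

Section Reduction.

Variables (q m n k : nat) (F : nat -> nat).

Lemma terminates_for_env r b c s N T (Inv : nat -> state -> Prop) :
  r \notin writes c ->
  all (fun x => x \notin writes (For r b c)) [:: 0; 1; 2; 3; 6; 10] ->
  (forall i s1 x, Inv i s1 -> Inv i (set_reg s1 r x)) ->
  env q m n k s -> reg s b = N -> Inv 0 s ->
  (forall i s1, i < N -> Inv i s1 -> env q m n k s1 ->
     frame (For r b c) s s1 -> terminates c s1 T (Inv i.+1)) ->
  terminates (For r b c) s (N * T.+2 + 2) (Inv N).
Proof.
move=> rc cP InvR e sb Inv0 InvS.
apply: terminates_for => //; last first.
- move=> i s1 lt_iN Inv1 fr; apply: InvS => //; exact: env_frame fr e cP.
- exact: env_1 e.
- exact: env_0 e.
have := allP cP 10 isT; have := allP cP 6 isT.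
rewrite /= !inE !mem_cat !inE !negb_or (eq_sym r 6) (eq_sym r 10) rc.
by case/and3P=> -> -> _ /and3P[-> ->].
Qed.

Lemma skip_matrix_spec M s : env q m n k s -> reg s 9 = q -> mem s = M ->
  terminates skip_matrix s (m * 3 + 2)
    (fun s' => reg s' 9 = q + m * n /\ mem s' = M).
Proof.
move=> e s9 sM.
apply: (terminates_for_env
  (Inv := fun i s' => reg s' 9 = q + i * n /\ mem s' = M)) e (env_m e) _ _ => //.
- by rewrite addn0.
- move=> i s1 lt_i [s1_9 s1M] e1 _.
  apply: terminates_run => //=; split=> //.
  by rewrite /update /= s1_9 mulSnr (env_n e1) addnA.
Qed.

Lemma write_transpose_spec T s : env q m n k s -> written F T s ->
  (forall i j, i < m -> j < n ->
     q + (i * n + j) < T /\ F (T + (j * m + i)) = F (q + (i * n + j))) ->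
  terminates write_transpose s (n * (m * 6 + 6) + 3) (written F (T + n * m)).
Proof.
move=> e sF FT.
apply: (@terminates_leq _ _ (1 + (n * (1 + ((m * 6 + 2) + 1)).+2 + 2))).
  by lia.
apply: (terminates_seq
  (Q1 := fun s' => written F T s' /\ reg s' 15 = q)) => [|s1 [s1F s1_15] fr1].
  apply: terminates_run => //; split; first exact: sF.
  by rewrite /= /update /= (env_0 e) (env_q e) addn0.
have {}e := env_frame fr1 e isT.
apply: terminates_weaken (terminates_for_env
  (Inv := fun j s' => written F (T + j * m) s' /\ reg s' 15 = q + j)
  _ _ _ e (env_n e) _ _) => //.
- by move=> s' [].
- by rewrite mul0n !addn0.
move=> j s2 lt_jn [s2F s2_15] e2 fr2.
apply: (terminates_seq
  (Q1 := fun s' => written F (T + j * m) s' /\ reg s' 12 = q + j)).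
  apply: terminates_run => //; split; first exact: s2F.
  by rewrite /= /update /= (env_0 e2) s2_15 addn0.
move=> s3 [s3F s3_12] fr3; have e3 := env_frame fr3 e2 isT.
apply: (terminates_seq
  (Q1 := fun s' => written F (T + (j * m + m)) s')).
  apply: terminates_weaken (terminates_for_env
    (Inv := fun i s' => written F (T + (j * m + i)) s' /\
              reg s' 12 = q + (i * n + j))
    _ _ _ e3 (env_m e3) _ _) => //.
  - by move=> s' [].
  - by rewrite addn0.
  move=> i s4 lt_im [s4F s4_12] e4 fr4.
  have [lt_T FT_ij] := FT i j lt_im lt_jn.
  apply: terminates_run => //; split.
    rewrite addnS addnS; apply: (written_push (a := 13)) => //.
    - exact: env_1 e4.
    rewrite /= /update /= s4_12 FT_ij; apply: (proj2 s4F).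
    by apply: leq_trans lt_T _; rewrite leq_addr.
  rewrite /= /update /= s4_12 (env_n e4); lia.
move=> s4 s4F fr4; have e4 := env_frame fr4 e3 isT.
apply: terminates_run => //; split; first by rewrite mulSnr.
by rewrite /= /update /= fr4 // fr3 // s2_15 (env_1 e4) addn1 addnS.
Qed.

Lemma write_table_spec U s : env q m n k s -> written F U s ->
  (forall i, i < n -> F (U + i) = U + n) -> F (U + n) = k ->
  terminates write_table s (n * 4 + 5) (written F (U + n).+1).
Proof.
move=> e sF FU FUn.
apply: (@terminates_leq _ _ (1 + ((n * 4 + 2) + 2))); first lia.
apply: (terminates_seq
  (Q1 := fun s' => written F U s' /\ reg s' 13 = U + n)).
  apply: terminates_run => //; split; first exact: sF.
  by rewrite /= /update /= (proj1 sF) (env_n e).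
move=> s1 [s1F s1_13] fr1; have e1 := env_frame fr1 e isT.
apply: (terminates_seq (Q1 := written F (U + n))).
  apply: terminates_weaken (terminates_for_env
    (Inv := fun i s' => written F (U + i) s')
    _ _ _ e1 (env_n e1) _ _) => //.
  - by rewrite addn0.
  move=> i s2 lt_in s2F e2 fr2; apply: terminates_run => //.
  rewrite addnS; apply: written_push => //; first exact: env_1 e2.
  by rewrite fr2 // s1_13 FU.
move=> s2 s2F fr2; have e2 := env_frame fr2 e1 isT.
apply: terminates_run => //; apply: written_push => //; first exact: env_1 e2.
by rewrite FUn (env_k e2).
Qed.

Lemma mul_q_spec w M s : env q m n k s -> reg s 17 = w -> mem s = M ->
  terminates mul_q s (q * 3 + 4) (fun s' => reg s' 17 = w * q /\ mem s' = M).
Proof.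
move=> e s17 sM.
apply: (@terminates_leq _ _ (1 + ((q * 3 + 2) + 1))); first lia.
apply: (terminates_seq
  (Q1 := fun s' => [/\ reg s' 17 = w, reg s' 18 = 0 & mem s' = M])).
  by apply: terminates_run.
move=> s1 [s1_17 s1_18 s1M] fr1; have e1 := env_frame fr1 e isT.
apply: (terminates_seq
  (Q1 := fun s' => reg s' 18 = w * q /\ mem s' = M)).
  apply: terminates_weaken (terminates_for_env
    (Inv := fun i s' => reg s' 18 = w * i /\ mem s' = M)
    _ _ _ e1 (env_q e1) _ _) => //.
  - by rewrite muln0.
  move=> i s2 lt_iq [s2_18 s2M] e2 fr2; apply: terminates_run => //; split=> //.
  by rewrite /= /update /= s2_18 fr2 // s1_17 mulnSr.
move=> s2 [s2_18 s2M] fr2; have e2 := env_frame fr2 e1 isT.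
apply: terminates_run => //; split=> //.
by rewrite /= /update /= s2_18 (env_0 e2) addn0.
Qed.

Lemma power_spec M s : env q m n k s -> mem s = M ->
  terminates power s (k * (q * 3 + 6) + 4)
    (fun s' => reg s' 16 = q ^ k /\ mem s' = M).
Proof.
move=> e sM.
apply: (@terminates_leq _ _ (1 + ((k * (q * 3 + 4).+2 + 2) + 1))); first lia.
apply: (terminates_seq (Q1 := fun s' => reg s' 17 = 1 /\ mem s' = M)).
  exact: terminates_run.
move=> s1 [s1_17 s1M] fr1; have e1 := env_frame fr1 e isT.
apply: (terminates_seq (Q1 := fun s' => reg s' 17 = q ^ k /\ mem s' = M)).
  apply: terminates_weaken (terminates_for_env
    (Inv := fun i s' => reg s' 17 = q ^ i /\ mem s' = M)
    _ _ _ e1 (env_k e1) _ _) => //.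
  move=> i s2 lt_ik [s2_17 s2M] e2 fr2; rewrite expnSr.
  exact: mul_q_spec.
move=> s2 [s2_17 s2M] fr2; have e2 := env_frame fr2 e1 isT.
apply: terminates_run => //; split=> //.
by rewrite /= /update /= s2_17 (env_0 e2) addn0.
Qed.

(** At position [p] of a tuple with block length [w], the letter is digit [p %/ w %% q] and
    [w - p %% w] repetitions remain. By [q <= a] the alphabet lies in the part already written, so
    the letter read is a value of [F]. *)
Lemma write_letter_spec a p w s : env q m n k s -> 0 < q -> 0 < w -> q <= a ->
  F (a + p) = F (p %/ w %% q) ->
  [/\ written F (a + p) s, reg s 12 = p %/ w %% q, reg s 14 = w - p %% w &
      reg s 17 = w] ->
  terminates write_letter s 10 (fun s' =>
    [/\ written F (a + p.+1) s', reg s' 12 = p.+1 %/ w %% q,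
        reg s' 14 = w - p.+1 %% w & reg s' 17 = w]).
Proof.
move=> e q_gt0 w_gt0 le_qa Fap [sF s12 s14 s17]; apply: terminates_run => //.
pose s1 := run (Read 13 12 ;; push 13 ;; Sub 14 14 10) s.
have s1F : written F (a + p.+1) s1.
  rewrite addnS; apply: (@written_push F (a + p) (run (Read 13 12) s)) => //.
    exact: env_1 e.
  rewrite /= /update /= s12 Fap; apply: (proj2 sF).
  by rewrite (leq_trans (ltn_pmod _ q_gt0)) // (leq_trans le_qa) ?leq_addr.
have s1_12 : reg s1 12 = p %/ w %% q by [].
have s1_14 : reg s1 14 = w - (p %% w).+1.
  by rewrite /= /update /= s14 (env_1 e) subn1 subnS.
have s1_17 : reg s1 17 = w by [].
have e1 : env q m n k s1 by case: e.
have -> : run write_letter s = run (If 14 Skip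
    (Add 14 17 6 ;; Add 12 12 10 ;; Sub 13 0 12 ;; If 13 Skip (Add 12 6 6))) s1.
  by [].
move: s1 s1F s1_12 s1_14 s1_17 e1.
move=> s1 s1F s1_12 s1_14 s1_17 e1.
have lt_pw : p %% w < w by rewrite ltn_mod.
rewrite divnS // modnS.
(* The repetition counter runs out exactly when position [p.+1] opens a new block. *)
have dvdE : (w %| p.+1) = (reg s1 14 == 0).
  rewrite s1_14 subn_eq0; case: (ltngtP w (p %% w).+1) => [||wE]; first lia.
    move=> lt; rewrite /dvdn -add1n -modnDmr add1n modn_small //.
  by rewrite /dvdn -add1n -modnDmr add1n -wE modnn.
rewrite dvdE /=; case: eqP => [s1_0|s1_N0]; last by [].
rewrite /update /= (env_q e1) (env_0 e1) (env_1 e1) s1_17 s1_12 add0n addn0.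
rewrite add1n addn1 subn0 modnS.
have lt_q : (p %/ w) %% q < q by rewrite ltn_mod.
(* The subtraction in register 13 vanishes exactly when the alphabet is exhausted and the letter
   wraps around to 0. *)
have -> : (q %| (p %/ w).+1) = (q - ((p %/ w) %% q).+1 == 0).
  rewrite subn_eq0; case: (ltngtP q ((p %/ w) %% q).+1) => [||qE]; first lia.
    by move=> lt; rewrite /dvdn -add1n -modnDmr add1n modn_small.
  by rewrite /dvdn -add1n -modnDmr add1n -qE modnn.
case: eqP => [_|_]; split=> //; rewrite /= /update /= ?(env_0 e1) //.
all: by rewrite ?s1_17 ?(env_q e1) ?(env_1 e1) ?s1_12 ?addn0 ?addn1.
Qed.

Lemma write_tuples_spec a s : env q m n k s -> 0 < q -> q <= a ->
  written F a s -> reg s 16 = q ^ k ->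
  (forall i j, i < k -> j < q ^ k ->
     F (a + (i * q ^ k + j)) = F (j %/ q ^ i %% q)) ->
  terminates write_tuples s (k * (q ^ k * 12 + q * 3 + 10) + 3)
    (written F (a + k * q ^ k)).
Proof.
set Q := q ^ k => e q_gt0 le_qa sF s16 FP.
apply: (@terminates_leq _ _
  (1 + (k * (2 + ((Q * 12 + 2) + (q * 3 + 4))).+2 + 2))).
  by rewrite !mulnDr; lia.
apply: (terminates_seq (Q1 := fun s' => written F a s' /\ reg s' 17 = 1)).
  exact: terminates_run.
move=> s1 [s1F s1_17] fr1; have e1 := env_frame fr1 e isT.
apply: terminates_weaken (terminates_for_env
  (Inv := fun i s' => written F (a + i * Q) s' /\ reg s' 17 = q ^ i)
  _ _ _ e1 (env_k e1) _ _) => //.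
- by move=> s' [].
- by rewrite addn0.
move=> i s2 lt_ik [s2F s2_17] e2 fr2.
have w_gt0 : 0 < q ^ i by rewrite expn_gt0 q_gt0.
(* The assertion is the invariant of the next loop at position 0, hence its unreduced form. *)
apply: (terminates_seq (Q1 := fun s' =>
  [/\ written F (a + i * Q + 0) s', reg s' 12 = 0 %/ q ^ i %% q,
      reg s' 14 = q ^ i - 0 %% q ^ i & reg s' 17 = q ^ i])).
  apply: terminates_run => //; rewrite addn0 div0n !mod0n subn0.
  split=> //; by rewrite /= /update /= s2_17 (env_0 e2) addn0.
move=> s3 s3P fr3; have e3 := env_frame fr3 e2 isT.
have s3_16 : reg s3 16 = Q by rewrite fr3 // fr2 // fr1.
apply: (terminates_seq (Q1 := fun s' =>
    written F (a + i * Q + Q) s' /\ reg s' 17 = q ^ i)).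
  apply: terminates_weaken (terminates_for_env
    (Inv := fun p s' =>
      [/\ written F (a + i * Q + p) s', reg s' 12 = p %/ q ^ i %% q,
          reg s' 14 = q ^ i - p %% q ^ i & reg s' 17 = q ^ i])
    _ _ _ e3 s3_16 _ _) => //.
  - by move=> s' [].
  move=> p s4 lt_pQ s4P e4 fr4; apply: write_letter_spec => //.
    by rewrite (leq_trans le_qa) ?leq_addr.
  by rewrite -addnA FP.
move=> s4 [s4F s4_17] fr4; have e4 := env_frame fr4 e3 isT.
apply: terminates_weaken (mul_q_spec e4 s4_17 (erefl (mem s4))).
move=> s5 [s5_17 s5M] fr5; rewrite expnSr mulSnr addnA; split=> //.
by rewrite /written s5M fr5.
Qed.

(** [F] stays abstract: the hypotheses are the equations on the final memory that the pieces rely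
    on, and [target] is later shown to satisfy them. *)
Lemma reduction_spec s :
  let T := q + m * n in let U := T + n * m in let V := U + n in
  reg s 0 = q -> reg s 1 = m -> reg s 2 = n -> reg s 3 = k ->
  0 < q ->
  (forall a, a < T -> mem s a = F a) ->
  (forall i j, i < m -> j < n ->
     q + (i * n + j) < T /\ F (T + (j * m + i)) = F (q + (i * n + j))) ->
  (forall i, i < n -> F (U + i) = V) ->
  F V = k ->
  (forall i j, i < k -> j < q ^ k ->
     F (V.+1 + (i * q ^ k + j)) = F (j %/ q ^ i %% q)) ->
  terminates reduction s
    (m * 3 + n * (m * 6 + 10) + k * (q ^ k * 12 + q * 6 + 16) + 26)
    (fun s' => [/\ written F (V.+1 + k * q ^ k) s',
       [/\ reg s' 0 = q, reg s' 1 = n, reg s' 2 = m & reg s' 3 = q ^ k] &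
       [/\ reg s' 6 = 0, reg s' 7 = T & reg s' 8 = U]]).
Proof.
move=> T U V s0 s1 s2 s3 q_gt0 MF FT FU FV FP.
apply: (@terminates_leq _ _ (3 + ((m * 3 + 2) + (1 + ((n * (m * 6 + 6) + 3) +
  (1 + ((n * 4 + 5) + ((k * (q * 3 + 6) + 4) +
   ((k * (q ^ k * 12 + q * 3 + 10) + 3) + 4))))))))); first by rewrite !mulnDr; lia.
apply: (terminates_seq (Q1 := fun s' => [/\ env q m n k s',
    reg s' 9 = q & mem s' = mem s])).
  apply: terminates_run => //; split=> //.
  by rewrite /= /update /= s0 addn0.
move=> {s0 s1 s2 s3} s1 [e1 s1_9 s1M] _.
apply: terminates_seq (skip_matrix_spec e1 s1_9 s1M) _.
move=> s2 [s2_9 s2M] fr2; have e2 := env_frame fr2 e1 isT.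
have s2F : written F T s2 by split=> // a lt_aT; rewrite s2M MF.
apply: (terminates_seq (Q1 := fun s' => written F T s' /\ reg s' 7 = T)).
  apply: terminates_run => //; split=> //.
  by rewrite /= /update /= s2_9 (env_0 e2) addn0.
move=> s3 [s3F s3_7] fr3; have e3 := env_frame fr3 e2 isT.
apply: terminates_seq (write_transpose_spec e3 s3F FT) _.
move=> s4 s4F fr4; have e4 := env_frame fr4 e3 isT.
apply: (terminates_seq (Q1 := fun s' => written F U s' /\ reg s' 8 = U)).
  apply: terminates_run => //; split=> //.
  by rewrite /= /update /= (proj1 s4F) (env_0 e4) addn0.
move=> s5 [s5F s5_8] fr5; have e5 := env_frame fr5 e4 isT.
apply: terminates_seq (write_table_spec e5 s5F FU FV) _.
move=> s6 s6F fr6; have e6 := env_frame fr6 e5 isT.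
apply: terminates_seq (power_spec e6 (erefl _)) _.
move=> s7 [s7_16 s7M] fr7; have e7 := env_frame fr7 e6 isT.
have s7F : written F V.+1 s7 by rewrite /written s7M fr7.
apply: terminates_seq (write_tuples_spec e7 q_gt0 _ s7F s7_16 FP) _.
  by rewrite /V /U /T; lia.
move=> s8 s8F fr8; have e8 := env_frame fr8 e7 isT.
have s8_7 : reg s8 7 = T by rewrite fr8 // fr7 // fr6 // fr5 // fr4.
have s8_8 : reg s8 8 = U by rewrite fr8 // fr7 // fr6.
have s8_16 : reg s8 16 = q ^ k by rewrite fr8.
have [s8_0 s8_1 s8_2 _ s8_6 _] := e8.
apply: terminates_run => //; split=> //; rewrite /= /update /=.
by rewrite s8_0 s8_1 s8_2 s8_6 s8_16 !addn0.
Qed.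

End Reduction.

(** * Layout of the final memory *)

Lemma ltn_row_major p r i j : i < p -> j < r -> i * r + j < p * r.
Proof. by move=> lt_ip lt_jr; nia. Qed.

(* The final memory: the input ends at T, the transpose at U, the table at V;
   cell V holds the number of tuples and is followed by the tuples. *)
Definition target (q m n k : nat) (M : nat -> nat) (a : nat) : nat :=
  let T := q + m * n in let U := T + n * m in let V := U + n in
  if a < T then M a
  else if a < U then M (q + ((a - T) %% m * n + (a - T) %/ m))
  else if a < V then V
  else if a == V then k
  else M ((a - V.+1) %% q ^ k %/ q ^ ((a - V.+1) %/ q ^ k) %% q).

Section Target.

Variables (q m n k : nat) (M : nat -> nat).

Let F := target q m n k M.
Let T := q + m * n.
Let U := T + n * m.
Let V := U + n.

Lemma target_input a : a < T -> F a = M a.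
Proof. by rewrite /F /target => ->. Qed.

Lemma target_transpose i j : i < m -> j < n ->
  q + (i * n + j) < T /\ F (T + (j * m + i)) = F (q + (i * n + j)).
Proof.
move=> lt_im lt_jn.
have lt_T : q + (i * n + j) < T by rewrite ltn_add2l ltn_row_major.
split=> //; rewrite (target_input lt_T) /F /target -/T.
rewrite ltnNge leq_addr /= ltn_add2l ltn_row_major //.
rewrite addKn modnMDl modn_small // divnMDl ?divn_small ?addn0 //.
exact: leq_ltn_trans lt_im.
Qed.

Lemma target_table i : i < n -> F (U + i) = V.
Proof.
move=> lt_in; rewrite /F /target -/T -/U -/V ltn_add2l lt_in.
by rewrite !ltnNge leq_addr /U -addnA leq_addr.
Qed.

Lemma target_size : F V = k.
Proof.
rewrite /F /target -/T -/U -/V eqxx ltnn.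
by rewrite !ltnNge /V leq_addr /U -addnA leq_addr.
Qed.

Lemma target_tuples i j : 0 < q -> i < k -> j < q ^ k ->
  F (V.+1 + (i * q ^ k + j)) = F (j %/ q ^ i %% q).
Proof.
move=> q_gt0 lt_ik lt_jQ; rewrite [RHS]target_input; last first.
  by rewrite (leq_trans (ltn_pmod _ q_gt0)) ?leq_addr.
have Q_gt0 : 0 < q ^ k by rewrite expn_gt0 q_gt0.
rewrite /F /target -/T -/U -/V; set b := _ + j.
have [-> -> -> ->] : [/\ V.+1 + b < T = false, V.+1 + b < U = false,
    V.+1 + b < V = false & (V.+1 + b == V) = false].
  by rewrite /V /U; split; lia.
by rewrite addKn /b modnMDl (modn_small lt_jQ) divnMDl // (divn_small lt_jQ) addn0.
Qed.

End Target.

Lemma holds_seq_flatten s a Q (ts : seq (seq nat)) :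
  (forall i, i < size ts -> size (nth [::] ts i) = Q) ->
  (forall i j, i < size ts -> j < Q ->
     mem s (a + (i * Q + j)) = nth 0 (nth [::] ts i) j) ->
  holds_seq s a (flatten ts).
Proof.
elim: ts a => [|t ts IHts] a szQ tsP i //=.
have szt : size t = Q := szQ 0 isT.
rewrite size_cat nth_cat szt => lt_i; case: ltnP => [lt_iQ|le_Qi].
  by rewrite -(tsP 0).
rewrite -[in LHS](subnKC le_Qi) addnA.
apply: (IHts (a + Q)); last by rewrite ltn_subLR.
  by move=> i'; apply: (szQ i'.+1).
move=> i' j lt_i' lt_jQ; rewrite -(tsP i'.+1 j) //.
by rewrite mulSn !addnA.
Qed.

(** * Combining the equivalence with the run of the machine *)

Theorem lemma5 :
  exists (P : cmd) (C : nat),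
  forall (Sigma : {fset nat}) (m n : nat) (hm : 0 < m) (hn : 0 < n)
    (X : fs_instance Sigma m n) (s : state),
  fs_input s X ->
  exists (Y : cco_instance Sigma n m) (t : nat) (s' : state),
    (exec P s t s' /\
     t <= C * (m * n + fs_k X * #|` Sigma|%fset ^ fs_k X) /\
     cco_output s' Y) /\
    ((fs_yes X <-> cco_yes Y) /\
     (fs_k X <= n -> (fs_yes_nonempty X <-> cco_yes Y))) /\
    [/\ cco_A Y = (fs_D X)^T%R,
        cco_k Y = #|` Sigma|%fset ^ fs_k X,
        cco_B Y = fs_B X &
        cco_l Y = fs_l X].
Proof.
(* The cost in [reduction_spec] needs at most 3 + 6 + 10 + 26 = 45 times [m * n] and 12 + 6 + 16 =
   34 times [k * q ^ k]; 80 exceeds both. *)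
exists reduction, 80 => Sigma m n hm hn X s.
move=> [[s0 [s1 [s2 [s3 [s4 s5]]]]] [[e eP eM] DM]].
set q := #|` Sigma|%fset; set k := fs_k X.
have sz_e : size e = q by rewrite (perm_size eP).
(* An entry of the non-empty matrix shows that the alphabet is non-empty and serves as the default
   letter. *)
pose a0 : Sigma := fs_D X (Ordinal hm) (Ordinal hn).
(* Letters are numbered in their storage order [e], so letter [d] is the content of cell [d]. *)
pose sigma d : Sigma := insubd a0 (nth 0 e d).
have q_gt0 : 0 < q by rewrite cardfs_gt0; apply/fset0Pn; exists (val a0); apply: valP.
have sigmaE d : d < q -> val (sigma d) = mem s d.
  move=> lt_dq; rewrite val_insubd -(perm_mem eP) mem_nth ?sz_e //.
  by rewrite -eM ?sz_e.
pose Q := q ^ k; have Q_gt0 : 0 < Q by rewrite expn_gt0 q_gt0.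
have k_gt0 : 0 < k := fs_k_gt0 X.
pose W (w : 'I_Q) (i : 'I_k) := sigma (w %/ q ^ i %% q).
have W_surj (u : 'I_k -> Sigma) : exists w, W w =1 u.
  (* [digits_surj] takes digits at all positions; those from [k] on are set to 0. *)
  pose d i := if insub i is Some i' then index (val (u i')) e else 0.
  have lt_dq i : d i < q.
    rewrite /d; case: insubP => // i' _ _.
    by rewrite -sz_e index_mem (perm_mem eP); apply: valP.
  have [w lt_wQ wP] := digits_surj k lt_dq.
  exists (Ordinal lt_wQ) => i; rewrite /W /= wP //.
  by apply: val_inj; rewrite val_insubd /d valK nth_index ?(perm_mem eP) ?fsvalP //.
exists (cco_of_fs W Q_gt0).
pose F := target q m n k (mem s).
have [|||||t [s' [ex le_t [[_ s'F] [s'0 s'1 s'2 s'3] [s'6 s'7 s'8]]]]] :=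
  @reduction_spec q m n k F s s0 s1 s2 s3 q_gt0.
- by move=> a lt_a; rewrite /F target_input.
- exact: target_transpose.
- exact: target_table.
- exact: target_size.
- by move=> i j; apply: target_tuples.
set T := q + m * n in s'F s'7 s'8; set U := T + n * m in s'F s'8.
set V := U + n in s'F.
exists t, s'; split; last first.
  split=> //; split; first exact: cco_of_fsP.
  by move=> le_kn; rewrite -(fs_yes_nonemptyP hn le_kn); apply: cco_of_fsP.
(* The input survives, so the alphabet need not be copied. *)
have s'in a : a < T -> mem s' a = mem s a.
  move=> lt_aT; rewrite s'F; first exact: target_input.
  by rewrite /V /U; lia.
split=> //; split.
  apply: leq_trans le_t _; rewrite -/q -/k -/Q.
  (* The lower-order terms in [k * q], [k], [m] and [n] are absorbed by [k * Q] and [m * n], all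
     parameters being positive. *)
  have : q <= Q by rewrite -{1}(expn1 q) leq_pexp2l.
  have : k <= k * Q by rewrite leq_pmulr.
  have : m <= m * n by rewrite leq_pmulr.
  have : n <= m * n by rewrite leq_pmull.
  move=> le_n le_m le_k /(leq_mul (leqnn k)) le_q.
  by rewrite !mulnDr; lia.
split.
  by do 4![split=> //]; split; rewrite (exec_frame ex) ?s4 ?s5.
split.
  exists e => // d; rewrite s'6 => lt_d; rewrite -eM // s'in //.
  by rewrite add0n /T ltn_addr -?sz_e.
split.
  move=> j i; rewrite s'7 !mxE -DM.
  have [lt_T FT] := @target_transpose q m n k (mem s) i j (ltn_ord i) (ltn_ord j).
  rewrite s'F /F; first by rewrite FT target_input.
  have := ltn_row_major (ltn_ord j) (ltn_ord i); rewrite /V /U; lia.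
move=> r; rewrite s'8 s'F; last by have := ltn_ord r; rewrite /V; lia.
rewrite [F _]target_table //.
(* Tuples may repeat in this list, for instance when [q = 1]; [holds_relation] only compares
   membership. *)
exists [seq [tuple W w i | w < Q] | i <- enum 'I_k]; split.
- move=> t'; apply/mapP/imsetP => [[i _ ->]|[i _ ->]]; exists i => //.
  by rewrite mem_enum.
- rewrite size_map size_enum_ord s'F; first exact: target_size.
  by lia.
apply: (@holds_seq_flatten _ _ Q); rewrite -map_comp size_map size_enum_ord.
  move=> i lt_ik; rewrite (nth_map (Ordinal lt_ik)) ?size_enum_ord //=.
  by rewrite 2!size_map size_enum_ord.
move=> i j lt_ik lt_jQ; rewrite (nth_map (Ordinal lt_ik)) ?size_enum_ord //=.
rewrite s'F; last first.
  by have := ltn_row_major lt_ik lt_jQ; rewrite -/Q -/V; lia.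
rewrite -map_comp (nth_map (Ordinal lt_jQ)) ?size_enum_ord //=.
rewrite sigmaE ?ltn_pmod // !nth_enum_ord //.
rewrite [F _]target_tuples // target_input //.
by rewrite (leq_trans (ltn_pmod _ q_gt0)) ?leq_addr.
Qed.
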